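(* Let $(X,\mathcal{G})$ be a topological space and let $F$ be a non-empty proper subset of $X$. Define $\mu:\mathcal{P}(X)\to\mathcal{P}(X)$ by $\mu(\emptyset)=\emptyset$ and $\mu(A)=A\cup F^c$ for $A\neq\emptyset$. Then the family $\mathcal{F}=\{\mu(A)^c : A\in\mathcal{P}(X)\}$ is a topology on $X$, and $F$ is dense in $(X,\mathcal{F})$.
   Context: $\mathcal{P}(X)$ denotes the set of all subsets of $X$, and $A^c=X\setminus A$ denotes the complement of $A$ in $X$. *)

(* Defs.v *)
From HB Require Import structures.
From mathcomp Require Import all_boot all_order.
From mathcomp Require Import boolp classical_sets topology.

Set Implicit Arguments.
Unset Strict Implicit.
Unset Printing Implicit Defensive.

Local Open Scope classical_set_scope.

Definition is_topology (T : Type) (tau : set (set T)) : Prop :=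
  [/\ tau set0,
      tau setT,
      forall A B, tau A -> tau B -> tau (A `&` B) &
      forall S : set (set T), S `<=` tau -> tau (\bigcup_(A in S) A)].

(* The carrier T retopologized by tau; the proof argument lets the canonical
   topologicalType structure be inferred from the type. *)
Definition space_of (T : choiceType) (tau : set (set T))
  (h : is_topology tau) : Type := T.

Section SpaceOf.
Context (T : choiceType) (tau : set (set T)) (h : is_topology tau).

HB.instance Definition _ := Choice.copy (space_of h) T.

Let tauT : tau setT. Proof. by case: h. Qed.

Let tauI : setI_closed tau. Proof. by case: h. Qed.

Let tau_bigU (I : Type) (f : I -> set T) :
  (forall i, tau (f i)) -> tau (\bigcup_i f i).
Proof.
move=> tauf; have [_ _ _ tauU] := h.
suff -> : \bigcup_i f i = \bigcup_(A in range f) A.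
  by apply: tauU => _ [i _ <-].
by rewrite bigcup_image.
Qed.

HB.instance Definition _ :=
  isOpenTopological.Build (space_of h) tauT tauI tau_bigU.

Lemma space_of_openE : @open (space_of h) = tau.
Proof. by []. Qed.

End SpaceOf.

Definition mu (T : Type) (F A : set T) : set T :=
  if pselect (A = set0) then set0 else A `|` ~` F.

Definition mu_family (T : Type) (F : set T) : set (set T) :=
  [set ~` mu F A | A in [set: set T]].

(* Main.v *)
Require Import Defs.
From HB Require Import structures.
From mathcomp Require Import all_boot all_order.
From mathcomp Require Import boolp classical_sets topology.

Local Open Scope classical_set_scope.

(** For nonempty [A] the complement of [mu F A] is [~` A `&` F], and every
    subset of [F] arises in this way, while [A = set0] contributes the whole
    space. So the family is the excluded-set topology: its members are the
    whole space and all the subsets of [F] ([mu_familyP]). In this form the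
    axioms of a topology are immediate ([mu_family_topology]), and a nonempty
    open set meets [F] because it either contains [F] or is contained in it. *)

Lemma mu_familyP (T : Type) (F U : set T) :
  mu_family F U <-> U = setT \/ U `<=` F.
Proof.
split=> [[A _ <-]|UF].
  rewrite /mu; case: pselect => [A0|An0] /=; first by left; rewrite setC0.
  by right; rewrite setCU setCK; exact: subIsetr.
(* The witness [~` U] serves both alternatives: it is empty exactly when
   [U = setT], which is the exceptional case of [mu]. *)
exists (~` U) => //; rewrite /mu; case: pselect => [UC0|UCN0] /=.
  by rewrite setC0 -[U]setCK UC0 setC0.
case: UF => [UT|UF]; first by case: UCN0; rewrite UT setCT.
by rewrite setCU !setCK; exact/setIidPl.
Qed.

Lemma mu_family_topology (T : Type) (F : set T) : is_topology (mu_family F).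
Proof.
split.
- by apply/mu_familyP; right.
- by apply/mu_familyP; left.
- move=> A B /mu_familyP[->|AF] muB; first by rewrite setTI.
  by apply/mu_familyP; right=> x [/AF].
- move=> S Smu; apply/mu_familyP.
  (* A union is the whole space as soon as one of its members is; otherwise
     all of its members are subsets of [F]. *)
  have [ST|SNT] := pselect (S setT).
    by left; rewrite -subTset => x _; exists setT.
  right=> x [A SA Ax].
  by have /mu_familyP[AT|] := Smu A SA; [case: SNT; rewrite -AT|exact].
Qed.

Theorem lemma2p2 (X : topologicalType) (F : set X)
  (F_neq0 : F !=set0) (F_proper : F <> [set: X]) :
  exists h : is_topology (mu_family F),
    dense (F : set (space_of h)).
Proof.
exists (mu_family_topology X F) => O [x Ox].
rewrite space_of_openE => /mu_familyP[->|OF]; first by rewrite setTI.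
by exists x; split => //; exact: OF.
Qed.
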